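(* Let $\mathcal D\subset\Omega_m^k$ be a set of $n\ge 1$ nodes and let $f=\sum_{\alpha\in\mathbb Z_m^k}b_\alpha z^\alpha$ be the polynomial representation of its indicator function over $\Omega_m^k$. Let $\lambda$ be a measure on $\mathbb C^k$ with finite moments. Let $S\subset S_m$ be a set of monomials such that the pair $(\mathcal D,\operatorname{Span}_{\mathbb C}(S))$ is correct, and let $$w_S=\left(X_{\mathcal D,S}^t\right)^{-1}\left[\int_{\mathbb C^k}s\,d\lambda\right]_{s\in S},\qquad X_{\mathcal D,S}=[s(d)]_{d\in\mathcal D,\,s\in S}.$$ Let $$A=\left\{z^\alpha\ :\ \alpha\in\mathbb Z_{\ge0}^k,\ \int_{\mathbb C^k}z^\alpha\,d\lambda=\frac{m^k}{n}\,b_{\overline\alpha}\right\}.$$ Then $w_S=\frac1n 1_n$ if and only if $S\subseteq A$.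
   Context: Here $m\ge1$ is an integer and $\Omega_m\subset\mathbb C$ is the set of $m$-th roots of unity. For $\alpha\in\mathbb Z_{\ge0}^k$, $z^\alpha=z_1^{\alpha_1}\cdots z_k^{\alpha_k}$. $\mathbb Z_m$ is the set of residues modulo $m$, identified with $\{0,\dots,m-1\}$, and $S_m=\{z^\alpha:\alpha\in\mathbb Z_m^k\}=\{z^\alpha: 0\le\alpha_i\le m-1\}$. For $\alpha\in\mathbb Z^k$, $\overline\alpha\in\mathbb Z_m^k$ denotes the vector of residues of $m-\alpha_i$ modulo $m$. The indicator function of $\mathcal D$ over $\Omega_m^k$ is the function on $\Omega_m^k$ equal to $1$ on $\mathcal D$ and $0$ on $\Omega_m^k\setminus\mathcal D$; it is represented by the unique polynomial $f=\sum_{\alpha\in\mathbb Z_m^k}b_\alpha z^\alpha\in\operatorname{Span}_{\mathbb C}(S_m)$ interpolating it, with $b_\alpha=\frac1{m^k}\sum_{d\in\mathcal D}z^{\overline\alpha}(d)$. The pair $(\mathcal D,\mathcal P)$, with $\mathcal P$ a set of polynomials, is correct if for every $g:\mathbb C^k\to\mathbb C$ there is a unique $p\in\mathcal P$ with $p(d)=g(d)$ for all $d\in\mathcal D$; for $\mathcal P=\operatorname{Span}_{\mathbb C}(S)$ this is equivalent to $X_{\mathcal D,S}$ being square and non-singular. $1_n$ is the vector of length $n$ with all entries equal to $1$; $t$ denotes transpose. *)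

(* Defs.v *)
From HB Require Import structures.
From mathcomp Require Import all_boot all_order all_algebra finmap.
From mathcomp Require Import all_classical all_reals all_analysis.
From mathcomp Require Import complex.
(* The notations of mpoly clash with those of mathcomp-analysis. *)
From mathcomp Require mpoly.
Import -(notations) mpoly.

Set Implicit Arguments.
Unset Strict Implicit.
Unset Printing Implicit Defensive.

Import Order.TTheory GRing.Theory Num.Theory.
Import numFieldNormedType.Exports.

Local Open Scope classical_set_scope.
Local Open Scope ring_scope.

(* R[i] packaged as a numClosedFieldType, so that 'rV[Cplx R]_k inherits the
   topology that mathcomp-analysis puts on matrices over a numFieldType. *)
Definition Cplx (R : realType) : numClosedFieldType := R[i].

(* C^k with its Borel sigma-algebra. *)
Definition borelC (R : realType) (k : nat) :=
  g_sigma_algebraType (open : set (set 'rV[Cplx R]_k)).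

Section Definitions.
Variables (R : realType) (k : nat).
Local Notation C := (Cplx R).
Local Notation poly := (mpoly k C).
Implicit Types (m : nat) (D : {fset 'rV[C]_k}) (S : {fset poly}).

Definition peval (p : poly) (z : 'rV[C]_k) : C := meval (fun i => z ord0 i) p.

Definition roots_of_unity m : set 'rV[C]_k :=
  [set z : 'rV[C]_k | forall i, m.-unity_root (z ord0 i)].

Definition monomials m : set poly :=
  [set mpolyX C a | a in [set a : multinom k | forall i, (a i < m)%N]].

Definition polyspan (T : set poly) : set poly :=
  [set p | exists F : {fset poly}, [set` F] `<=` T /\
           exists c : poly -> C, p = \sum_(s <- F) c s *: s].

Definition indicator_poly m D (f : poly) : Prop :=
  polyspan (monomials m) f /\
  forall z : 'rV[C]_k, roots_of_unity m z -> peval f z = (z \in D)%:R.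

Definition correct D (P : set poly) : Prop :=
  forall g : 'rV[C]_k -> C,
    exists! p, P p /\ forall d, d \in D -> peval p d = g d.

(* The subtraction is taken in int: a i may exceed m. *)
Definition conj_index m (a : multinom k) : multinom k :=
  Multinom [tuple absz ((m%:Z - (a i)%:Z) %% m%:Z)%Z | i < k].

Definition cintegrable (lam : {measure set (borelC R k) -> \bar R})
    (h : borelC R k -> C) : Prop :=
  lam.-integrable setT (EFin \o (fun z => complex.Re (h z))) /\
  lam.-integrable setT (EFin \o (fun z => complex.Im (h z))).

Definition cintegral (lam : {measure set (borelC R k) -> \bar R})
    (h : borelC R k -> C) : C :=
  Complex (\int[lam]_z complex.Re (h z))%R (\int[lam]_z complex.Im (h z))%R.

Definition finite_moments (lam : {measure set (borelC R k) -> \bar R}) : Prop :=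
  forall a : multinom k, cintegrable lam (peval (mpolyX C a)).

Definition design_mx D S : 'M[C]_(#|` D|, #|` S|) :=
  \matrix_(i, j) peval (nth 0 S j) (nth 0 D i).

Definition moment_vec (lam : {measure set (borelC R k) -> \bar R}) S :
    'cV[C]_#|` S| :=
  \col_j cintegral lam (peval (nth 0 S j)).

Lemma peval_sum I (r : seq I) (c : I -> C) (s : I -> poly) z :
  peval (\sum_(i <- r) c i *: s i) z = \sum_(i <- r) c i * peval (s i) z.
Proof.
by rewrite /peval raddf_sum; apply: eq_bigr => i _ /=; rewrite mevalZ.
Qed.

Lemma polyspan_fset S p : polyspan [set` S] p ->
  exists c : poly -> C, p = \sum_(s <- S) c s *: s.
Proof.
move=> [F [FS [c ->]]]; exists (fun s => if s \in F then c s else 0).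
have sFS : {subset F <= S} by move=> s sF; exact: (FS s sF).
rewrite -(@big_fset_incl _ _ _ _ F S).
- by apply: eq_big_seq => s sF; rewrite sF.
- exact/fsubsetP.
- by move=> s _ /negbTE ->; rewrite scale0r.
Qed.

(* The design matrix of a correct pair is square. *)
Lemma correct_card m D S :
  [set` S] `<=` monomials m -> correct D (polyspan [set` S]) -> #|` S| = #|` D|.
Proof.
move=> Sm cor; set X := design_mx D S.
have Xc (c : poly -> C) (i : 'I_#|` D|) :
    (X *m \col_j c (nth 0 S j)) i ord0
    = peval (\sum_(s <- S) c s *: s) (nth 0 D i).
  rewrite peval_sum mxE (big_nth 0) big_mkord.
  by apply: eq_bigr => j _; rewrite !mxE mulrC.
have fullX : row_free X.
  have /fin_all_exists[B BE] (l : 'I_#|` D|) : exists B : 'cV[C]_#|` S|,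
      X *m B = delta_mx l ord0.
    have [p [[/polyspan_fset[c ->] pD] _]] :=
      cor (fun z => (index z D == l)%:R).
    exists (\col_j c (nth 0 S j)); apply/matrixP => i j.
    rewrite (ord1 j) Xc pD ?mem_nth // index_uniq ?fset_uniq // mxE eqxx andbT.
    by [].
  apply/row_freeP; exists (\matrix_(j, l) B l j ord0).
  apply/matrixP => i l; have /matrixP/(_ i ord0) := BE l.
  rewrite !mxE eqxx andbT => <-.
  by apply: eq_bigr => j _; rewrite !mxE.
have freeX : row_free X^T.
  apply: inj_row_free => v vX0.
  pose c (s : poly) : C := \sum_(j < #|` S| | nth 0 S j == s) v ord0 j.
  have cE (j : 'I_#|` S|) : c (nth 0 S j) = v ord0 j.
    rewrite /c (big_pred1 j) // => l /=.
    by rewrite nth_uniq ?fset_uniq.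
  have colc : \col_j c (nth 0 S j) = v^T.
    by apply/matrixP => j l; rewrite !mxE cE (ord1 l).
  have [q [_ uq]] := cor (fun=> 0).
  have p0 : \sum_(s <- S) c s *: s = 0 :> poly.
    transitivity q; first symmetry; apply: uq; split.
    - by exists S; split=> //; exists c.
    - move=> d dD; have dlt : (index d D < #|` D|)%N by rewrite index_mem.
      rewrite -(nth_index 0 dD) -(Xc c (Ordinal dlt)) colc.
      by rewrite -[X]trmxK -trmx_mul vX0 !mxE.
    - exists fset0; split; first by move=> s; rewrite /= inE.
      by exists (fun=> 0); rewrite big_seq_fset0.
    - by move=> d _; rewrite /peval meval0.
  apply/rowP => j; rewrite mxE -cE.
  have Sj : (nth 0 S j : poly) \in S by rewrite mem_nth.
  have [a _ aj] := Sm _ Sj.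
  have := congr1 (mcoeff a) p0; rewrite mcoeff0 raddf_sum /=.
  rewrite (big_fsetD1 _ Sj) /= mcoeffZ -{2}aj mcoeffX eqxx mulr1.
  rewrite big_seq big1 ?addr0 // => s; rewrite !inE => /andP[sj sS].
  have [b _ bs] := Sm _ sS; rewrite -bs mcoeffZ mcoeffX.
  case: eqP => [ba|]; last by rewrite mulr0.
  by move: sj; rewrite -bs -aj ba eqxx.
by move: (eqP freeX) (eqP fullX); rewrite mxrank_tr => -> ->.
Qed.

Definition weights (lam : {measure set (borelC R k) -> \bar R}) m D S
    (Sm : [set` S] `<=` monomials m) (cor : correct D (polyspan [set` S])) :
    'cV[C]_#|` D| :=
  let e := correct_card Sm cor in
  invmx (castmx (e, erefl) (design_mx D S)^T) *m
    castmx (e, erefl) (moment_vec lam S).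

Definition matching_monomials (lam : {measure set (borelC R k) -> \bar R})
    m n (f : poly) : set poly :=
  [set mpolyX C a | a in [set a : multinom k |
     cintegral lam (peval (mpolyX C a)) =
     (m ^ k)%:R / n%:R * mcoeff (conj_index m a) f]].

End Definitions.

(* Main.v *)
Require Import Defs.
From mathcomp Require Import all_boot all_order all_algebra finmap.
From mathcomp Require Import all_classical all_reals all_analysis.
From mathcomp Require mpoly.
From mathcomp Require Import cyclic separable cyclotomic.
Import -(notations) mpoly.

Import Order.TTheory GRing.Theory Num.Theory.
Import numFieldNormedType.Exports.

Local Open Scope classical_set_scope.
Local Open Scope ring_scope.

(** Correctness of (D, Span S) makes the design matrix X invertible, so the
    weights are all 1/n exactly when the equal-weight rule solves
    X^t w = moments, that is, when every monomial s of S has the integral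
    (1/n) \sum_(d in D) s(d) ([weights_eqE]).

    It remains to read these node sums off the indicator polynomial f
    ([sum_nodes_monomial]).  As f is 1 on D and 0 elsewhere on the grid of
    vectors of m-th roots of unity, the sum of z^a over D is the sum of
    f(z) z^a over the whole grid.  Expanding f into monomials z^b, the grid
    sum of z^(a + b) factors into one-variable power sums over the m-th roots
    of unity, which vanish unless m divides every a_i + b_i
    ([sum_grid_monomial]).  Among exponents b with entries below m, only the
    residues of the m - a_i satisfy this, so the sum over D is m^k times the
    coefficient of f at that exponent.  Dividing by n turns the condition on
    s = z^a into the one that defines the matching monomials. *)

(** The m roots of X^m - 1 are distinct in characteristic 0, and m distinct
    m-th roots of unity in a field include a primitive one. *)
Lemma prim_root_exists (F : numClosedFieldType) m :
  (0 < m)%N -> exists w : F, m.-primitive_root w.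
Proof.
move=> m_gt0; pose p : {poly F} := 'X^m - 1.
have [r Dp] := closed_field_poly_normal p.
rewrite (monicP _) ?monicXnsubC // scale1r in Dp.
have r1 : all m.-unity_root r.
  by apply/allP => z; rewrite -root_prod_XsubC -Dp.
have size_r : (m < (size r).+1)%N.
  by rewrite -(size_prod_XsubC r id) -Dp size_XnsubC.
have uniq_r : uniq r.
  by rewrite -separable_prod_XsubC -Dp separable_Xn_sub_1 // pnatr_eq0 -lt0n.
by have /hasP[w _ wP] := has_prim_root m_gt0 r1 uniq_r size_r; exists w.
Qed.

(** The case where m does not divide t: the sum is geometric of ratio
    w^t != 1, and (w^t)^m = 1. *)
Lemma sum_prim_root_expr (F : fieldType) m (w : F) t : m.-primitive_root w ->
  \sum_(j < m) (w ^+ j) ^+ t = if (m %| t)%N then m%:R else 0.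
Proof.
move=> wP; have -> : \sum_(j < m) (w ^+ j) ^+ t = \sum_(j < m) (w ^+ t) ^+ j.
  by apply: eq_bigr => j _; rewrite exprAC.
rewrite (prim_order_dvd wP); case: eqP => [->|/eqP wt1].
  rewrite (eq_bigr (fun=> 1)) => [|j _]; last by rewrite expr1n.
  by rewrite sumr_const card_ord.
have /eqP := subrX1 (w ^+ t) m.
rewrite exprAC (prim_expr_order wP) expr1n subrr eq_sym mulf_eq0 subr_eq0.
by rewrite (negbTE wt1) => /eqP.
Qed.

(** The residue compared with b is [conj_index] at one coordinate, so this turns the
    divisibility produced by power sums into equality of exponents. *)
Lemma eq_conj_residue m a b : (b < m)%N ->
  (b == absz ((m%:Z - a%:Z) %% m%:Z)%Z) = (m %| b + a)%N.
Proof.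
move=> bm; have m0 : m%:Z != 0 by case: m bm.
rewrite -eqz_nat gez0_abs ?modz_ge0 //.
rewrite -[in LHS](@modz_small b%:Z m%:Z) ?ltz_nat // modzDl eqz_mod_dvd.
by rewrite opprK.
Qed.

(** Stated for an arbitrary equality of the dimensions, so that eliminating
    it removes the casts that occur in [weights]. *)
Lemma invmx_cast_mulE (F : fieldType) n1 n2 (e : n1 = n2)
    (X : 'M[F]_(n2, n1)) (v : 'cV_n1) (c : 'cV_n2) :
  row_full X ->
  invmx (castmx (e, erefl) X^T) *m castmx (e, erefl) v = c <-> X^T *m c = v.
Proof.
case: n2 / e X c => X c; rewrite !castmx_id => Xfull.
have XU : X^T \in unitmx by rewrite unitmx_tr -row_full_unit.
by split=> [<-|<-]; rewrite ?mulKVmx ?mulKmx.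
Qed.

Section Cubature.
Variables (R : realType) (k : nat).
Local Notation C := (Cplx R).
Local Notation poly := (mpoly k C).
Implicit Types (D : {fset 'rV[C]_k}) (S : {fset poly}).

Lemma peval_mpolyX a (z : 'rV[C]_k) :
  peval (mpolyX C a) z = \prod_(i < k) z ord0 i ^+ a i.
Proof. exact: mevalX. Qed.

Lemma conj_indexE m (a : multinom k) i :
  conj_index m a i = absz ((m%:Z - (a i)%:Z) %% m%:Z)%Z.
Proof. exact: mnmE. Qed.

(** Interpolating the indicator function of each node gives the columns of a
    right inverse of the design matrix. *)
Lemma design_mx_row_free D S :
  correct D (polyspan [set` S]) -> row_free (design_mx D S).
Proof.
move=> cor.
have /fin_all_exists[B BE] (l : 'I_#|` D|) : exists B : 'cV[C]_#|` S|,
    design_mx D S *m B = delta_mx l ord0.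
  have [p [[/polyspan_fset[c ->] pD] _]] :=
    cor (fun z => (index z D == l)%:R).
  exists (\col_j c (nth 0 S j)); apply/matrixP => i j.
  have := pD (nth 0 D i) (mem_nth _ (ltn_ord i)).
  rewrite peval_sum index_uniq ?fset_uniq // (ord1 j) !mxE eqxx andbT => <-.
  by rewrite (big_nth 0) big_mkord; apply: eq_bigr => s _; rewrite !mxE mulrC.
apply/row_freeP; exists (\matrix_(j, l) B l j ord0).
apply/matrixP => i l; have /matrixP/(_ i ord0) := BE l.
by rewrite !mxE eqxx andbT => <-; apply: eq_bigr => j _; rewrite !mxE.
Qed.

Lemma weights_eqE (lam : {measure set (borelC R k) -> \bar R}) m D S
    (Sm : [set` S] `<=` monomials m) (cor : correct D (polyspan [set` S]))
    (c : 'cV[C]_#|` D|) :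
  weights lam Sm cor = c <-> (design_mx D S)^T *m c = moment_vec lam S.
Proof.
apply: invmx_cast_mulE.
by rewrite /row_full (eqP (design_mx_row_free _ _ cor)) (correct_card Sm cor).
Qed.

Variables (m : nat) (w : C).
Hypothesis wP : m.-primitive_root w.

(** With w a primitive root, the exponents h parametrise the vectors of m-th
    roots of unity bijectively; the finite index type makes sums over them
    ordinary big operators that distribute over products of coordinates. *)
Definition grid (h : {ffun 'I_k -> 'I_m}) : 'rV[C]_k := \row_i w ^+ h i.

Lemma grid_inj : injective grid.
Proof.
move=> g h /rowP gh; apply/ffunP => i; apply/val_inj/eqP.
by have /eqP := gh i; rewrite !mxE (eq_prim_root_expr wP) !modn_small.
Qed.

Lemma grid_root h : roots_of_unity m (grid h).
Proof.
by move=> i; rewrite mxE unity_rootE exprAC (prim_expr_order wP) expr1n.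
Qed.

Lemma roots_of_unity_grid z : roots_of_unity m z -> exists h, z = grid h.
Proof.
move=> zr; have /fin_all_exists[h hE] i : exists j : 'I_m, z ord0 i = w ^+ j.
  by have [j zj] := prim_rootP wP (unity_rootP (zr i)); exists j.
by exists (finfun h); apply/rowP => i; rewrite mxE ffunE hE.
Qed.

Lemma sum_fset_grid D (g : 'rV[C]_k -> C) : [set` D] `<=` roots_of_unity m ->
  \sum_(d <- D) g d = \sum_h (grid h \in D)%:R * g (grid h).
Proof.
move=> Dr; under [RHS]eq_bigr => h _ do rewrite mulr_natl mulrb.
rewrite -big_mkcond -big_filter -(big_map grid xpredT g).
apply: perm_big; apply: uniq_perm; rewrite ?fset_uniq //.
  by rewrite (map_inj_uniq grid_inj) filter_uniq ?index_enum_uniq.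
move=> d; apply/idP/mapP => [dD|[h]].
  have [h dh] := roots_of_unity_grid _ (Dr _ dD).
  by exists h; rewrite // mem_filter -dh dD mem_index_enum.
by rewrite mem_filter => /andP[hD _] ->.
Qed.

(** Orthogonality of the monomials on the grid: the sum of products over all
    h is the product over coordinates of one-variable power sums. *)
Lemma sum_grid_monomial (a b : multinom k) : (forall i, b i < m)%N ->
  \sum_h peval (mpolyX C b) (grid h) * peval (mpolyX C a) (grid h)
  = (m ^ k)%:R * (b == conj_index m a)%:R.
Proof.
move=> bm.
have -> : \sum_h peval (mpolyX C b) (grid h) * peval (mpolyX C a) (grid h)
    = \prod_(i < k) \sum_(j < m) (w ^+ j) ^+ (b i + a i).
  rewrite bigA_distr_bigA; apply: eq_bigr => h _.
  rewrite !peval_mpolyX -big_split /=; apply: eq_bigr => i _.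
  by rewrite !mxE -exprD.
under eq_bigr => i _ do rewrite (sum_prim_root_expr _ _ _ _ wP)
  -(eq_conj_residue _ _ _ (bm i)) -conj_indexE.
have [->|/eqP ba] := eqVneq b (conj_index m a).
  rewrite mulr1 natrX -[k in RHS]card_ord -prodr_const.
  by apply: eq_bigr => i _; rewrite eqxx.
have [i bai] : exists i, b i != conj_index m a i.
  by apply/existsP; rewrite -negb_forall; apply/negP => /forallP ab;
     apply/ba/mnmP => i; apply/eqP.
by rewrite (bigD1 i) //= (negbTE bai) mul0r mulr0.
Qed.

(** Discrete Fourier inversion: grid sums recover the coefficients of a
    polynomial in the span of the reduced monomials. *)
Lemma sum_grid_mcoeff (p : poly) a : polyspan (monomials m) p ->
  \sum_h peval p (grid h) * peval (mpolyX C a) (grid h)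
  = (m ^ k)%:R * mcoeff (conj_index m a) p.
Proof.
move=> [F [Fm [c ->]]].
under eq_bigr => h _ do rewrite peval_sum mulr_suml.
rewrite exchange_big raddf_sum mulr_sumr; apply: eq_big_seq => s sF /=.
have [b bm <-] := Fm _ sF; rewrite mcoeffZ mcoeffX mulrCA -sum_grid_monomial //.
by rewrite mulr_sumr; apply: eq_bigr => h _; rewrite mulrA.
Qed.

End Cubature.

(** The indicator property replaces the sum over D by a sum over the whole
    grid weighted by f, to which Fourier inversion applies. *)
Lemma sum_nodes_monomial (R : realType) (m k : nat) (D : {fset 'rV[Cplx R]_k})
    (f : mpoly k (Cplx R)) (a : multinom k) :
  (0 < m)%N -> [set` D] `<=` roots_of_unity m -> indicator_poly m D f ->
  \sum_(d <- D) peval (mpolyX (Cplx R) a) d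
  = (m ^ k)%:R * mcoeff (conj_index m a) f.
Proof.
move=> m_gt0 Dr [fm fD]; have [w wP] := prim_root_exists (Cplx R) _ m_gt0.
rewrite -(sum_grid_mcoeff _ _ _ _ wP) // (sum_fset_grid _ _ _ _ wP) //.
by apply: eq_bigr => h _; rewrite fD //; apply: grid_root wP _.
Qed.

Theorem theorem1 (R : realType) (m k n : nat) (hm : (1 <= m)%N) (hn : (1 <= n)%N)
    (D : {fset 'rV[Cplx R]_k}) (hD : [set` D] `<=` roots_of_unity m)
    (hcard : #|` D| = n)
    (f : mpoly k (Cplx R)) (hf : indicator_poly m D f)
    (lam : {measure set (borelC R k) -> \bar R}) (hlam : finite_moments lam)
    (S : {fset mpoly k (Cplx R)}) (hS : [set` S] `<=` monomials m)
    (hDS : correct D (polyspan [set` S])) :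
  weights lam hS hDS = const_mx (n%:R^-1) <->
  [set` S] `<=` matching_monomials lam m n f.
Proof.
rewrite weights_eqE.
(* The equal-weight rule applied to a monomial of S, through the
   coefficients of f. *)
have momentE (j : 'I_#|` S|) (a : multinom k) : mpolyX (Cplx R) a = nth 0 S j ->
    ((design_mx D S)^T *m const_mx n%:R^-1 : 'cV_#|` S|) j ord0
    = (m ^ k)%:R / n%:R * mcoeff (conj_index m a) f.
  move=> aj; rewrite mulrAC -(sum_nodes_monomial _ _ _ _ _ _ hm hD hf).
  rewrite (big_nth 0) big_mkord mulr_suml mxE.
  by apply: eq_bigr => i _; rewrite !mxE aj.
split=> [E s sS|SA].
  have [a _ as_] := hS _ sS; exists a; last by [].
  have sj : (index s S < #|` S|)%N by rewrite index_mem.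
  have aj : mpolyX (Cplx R) a = nth 0 S (Ordinal sj) by rewrite as_ nth_index.
  have /colP/(_ (Ordinal sj)) := E.
  by rewrite (momentE _ _ aj) mxE -aj => /esym.
apply/colP => j; have [a aA aj] := SA _ (mem_nth 0 (ltn_ord j)).
by rewrite (momentE _ _ aj) mxE -aA aj.
Qed.
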